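(* Let $B$ be a flat-top front on $\omega$ and let $\vec{\mathcal{U}}=(\mathcal{U}_c:c\in\hat B^-)$ be a sequence of nonprincipal p-points on $\omega$. Then the ultrafilter $\mathcal{U}$ on base set $B$ generated by the $\vec{\mathcal{U}}$-trees has basic Tukey reductions. Consequently, every countable iteration of Fubini products of p-points (represented in this way) has basic Tukey reductions.
   Context: For finite $a,b\subseteq\omega$, $a\sqsubseteq b$ means $a$ is an initial segment of $b$ in increasing enumeration, $\sqsubset$ the proper version; same for $a\sqsubset X$ with $X$ infinite. A front on $\omega$ is $B\subseteq[\omega]^{<\omega}$ with no $a\sqsubset b$ for $a,b\in B$, such that every infinite $X\subseteq\omega$ has some $b\in B$ with $b\sqsubset X$. $B$ is a flat-top front if it is a front, $B\neq\{\emptyset\}$, and either $B=[\omega]^1$, or $B\subseteq[\omega]^{\ge 2}$ and for each $b\in B$, with $a=b\setminus\{\max b\}$, $\{c\setminus a: c\in B, c\sqsupset a\}=\{\{n\}:n>\max a\}$. $\hat B$ is the set of all initial segments of members of $B$ (including $\emptyset$), $\hat B^-=\hat B\setminus B$. A $\vec{\mathcal{U}}$-tree is a $\sqsubseteq$-downward closed $T\subseteq\hat B$ with $\emptyset\in T$ such that for each $c\in T\cap\hat B^-$, $\{n: c\cup\{n\}\in T\}\in\mathcal{U}_c$; $\mathfrak{T}$ is the set of $\vec{\mathcal{U}}$-trees and $[T]=T\cap B$ is the set of maximal branches of $T$. The ultrafilter generated is $\mathcal{U}=\{X\subseteq B:\exists T\in\mathfrak{T}\ ([T]\subseteq X)\}$.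 Every countable iteration of Fubini products $\lim_{n\to\mathcal{W}}\mathcal{V}_n=\{A\subseteq\omega\times\omega:\{n:\{j:(n,j)\in A\}\in\mathcal{V}_n\}\in\mathcal{W}\}$ of p-points is isomorphic to such an ultrafilter. For $A\subseteq\hat B$ and $k<\omega$, $A\restriction k=\{a\in A: a=\emptyset\text{ or }\max a<k\}$. A map $f:\mathcal{U}\to\mathcal{V}$ ($\mathcal{V}$ an ultrafilter on $\omega$) is monotone if $X\supseteq Y\Rightarrow f(X)\supseteq f(Y)$ and cofinal if it maps cofinal subsets of $(\mathcal{U},\supseteq)$ to cofinal subsets of $(\mathcal{V},\supseteq)$. Given $\tilde T\in\mathfrak{T}$ and strictly increasing $(n_k)_{k<\omega}$, a family $\hat f$ assigning to each $k$ and each $A\subseteq\tilde T\restriction n_k$ a set $\hat f_k(A)\subseteq k$ is basic if it is end-extension preserving ($\hat f_k(A'\restriction n_k)=\hat f_m(A')\cap k$ for $k<m$, $A'\subseteq\tilde T\restriction n_m$) and monotone ($A\subseteq A'\subseteq\tilde T\restriction n_k$ implies $\hat f_k(A)\subseteq\hat f_k(A')$); it generates $f$ on $\mathfrak{T}\restriction\tilde T$ if $f([T])=\bigcup_k\hat f_k(T\restriction n_k)$ for every $T\in\mathfrak{T}$ with $T\subseteq\tilde T$. $\mathcal{U}$ has basic Tukey reductions if for every monotone cofinal $f:\mathcal{U}\to\mathcal{V}$ there exist $\tilde T\in\mathfrak{T}$ and a basic $\hat f$ generating $f$ on $\mathfrak{T}\restriction\tilde T$. *)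

(* Defs.v *)
From mathcomp Require Import all_boot finmap.
From mathcomp Require Import boolp classical_sets functions cardinality filter.

Set Implicit Arguments.
Unset Strict Implicit.
Unset Printing Implicit Defensive.

Local Open Scope classical_set_scope.

Definition fmax (a : {fset nat}) : nat := \max_(x <- a) x.

(* Initial segments, for finite and infinite X alike: a finite b is passed as
   [set` b]. *)
Definition init_seg (a : {fset nat}) (X : set nat) : Prop :=
  [set` a] `<=` X /\
  forall x y : nat, X x -> y \in a -> x <= y -> x \in a.

Definition proper_init_seg (a : {fset nat}) (X : set nat) : Prop :=
  init_seg a X /\ [set` a] <> X.

Definition front (B : set {fset nat}) : Prop :=
  (forall a b, B a -> B b -> ~ proper_init_seg a [set` b]) /\
  (forall X : set nat, infinite_set X -> exists2 b, B b & proper_init_seg b X).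

Definition flat_top_front (B : set {fset nat}) : Prop :=
  [/\ front B,
      B <> [set fset0]
    & B = [set a : {fset nat} | #|` a| = 1] \/
      (B `<=` [set a : {fset nat} | 2 <= #|` a|] /\
       forall b, B b ->
         let a := (b `\ fmax b)%fset in
         [set (c `\` a)%fset | c in B `&` [set c | proper_init_seg a [set` c]]] =
         [set [fset n]%fset | n in [set n | fmax a < n]])].

Definition hat (B : set {fset nat}) : set {fset nat} :=
  [set a | exists2 b, B b & init_seg a [set` b]].

Definition hatm (B : set {fset nat}) : set {fset nat} := hat B `\` B.

Definition nonprincipal {T : Type} (U : set_system T) : Prop :=
  forall x, U <> principal_filter x.

Definition ppoint (U : set_system nat) : Prop :=
  UltraFilter U /\
  forall X : nat -> set nat, (forall n, U (X n)) ->
    exists2 Y, U Y & forall n, finite_set (Y `\` X n).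

(* Uc : {fset nat} -> set_system nat is the family (U_c), of which only the
   values at c in hatm B matter.  For n <= max c the condition n |` c in T does
   not say that n |` c is a successor of c; only finitely many n are involved. *)
Definition utree (B : set {fset nat}) (Uc : {fset nat} -> set_system nat)
    (T : set {fset nat}) : Prop :=
  [/\ T `<=` hat B,
      (forall a b, T b -> init_seg a [set` b] -> T a),
      T fset0
    & forall c, (T `&` hatm B) c -> Uc c [set n | T (n |` c)%fset]].

Definition branches (B T : set {fset nat}) : set {fset nat} := T `&` B.

Definition generated (B : set {fset nat}) (Uc : {fset nat} -> set_system nat) :
    set_system {fset nat} :=
  [set X | X `<=` B /\ exists2 T, utree B Uc T & branches B T `<=` X].

Definition restr (A : set {fset nat}) (k : nat) : set {fset nat} :=
  [set a | A a /\ (a = fset0 \/ fmax a < k)].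

Section CofinalMaps.
Context {T S : Type}.
Implicit Types (U : set_system T) (V : set_system S) (f : set T -> set S).

Definition cofinal_in {R : Type} (U C : set_system R) : Prop :=
  C `<=` U /\ forall X, U X -> exists2 Y, C Y & Y `<=` X.

(* f is a total function, standing for its restriction to U. *)
Definition maps_to U V f : Prop := forall X, U X -> V (f X).

Definition monotone_map U f : Prop :=
  forall X Y, U X -> U Y -> Y `<=` X -> f Y `<=` f X.

Definition cofinal_map U V f : Prop :=
  forall C, cofinal_in U C -> cofinal_in V (f @` C).
End CofinalMaps.

Definition basic_family (T0 : set {fset nat}) (n : nat -> nat)
    (fh : nat -> set {fset nat} -> set nat) : Prop :=
  [/\ (forall k A, A `<=` restr T0 (n k) -> fh k A `<=` [set j | j < k]),
      (forall k m A, k < m -> A `<=` restr T0 (n m) ->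
         fh k (restr A (n k)) = fh m A `&` [set j | j < k])
    & (forall k A A', A `<=` A' -> A' `<=` restr T0 (n k) ->
         fh k A `<=` fh k A')].

Definition generates (B : set {fset nat}) (Uc : {fset nat} -> set_system nat)
    (T0 : set {fset nat}) (n : nat -> nat)
    (fh : nat -> set {fset nat} -> set nat)
    (f : set {fset nat} -> set nat) : Prop :=
  forall T, utree B Uc T -> T `<=` T0 ->
    f (branches B T) = \bigcup_k fh k (restr T (n k)).

Definition basic_Tukey_reductions (B : set {fset nat})
    (Uc : {fset nat} -> set_system nat) : Prop :=
  forall (V : set_system nat) (f : set {fset nat} -> set nat),
    UltraFilter V ->
    maps_to (generated B Uc) V f ->
    monotone_map (generated B Uc) f ->
    cofinal_map (generated B Uc) V f ->
    exists (T0 : set {fset nat}) (n : nat -> nat)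
           (fh : nat -> set {fset nat} -> set nat),
      [/\ utree B Uc T0,
          (forall i j, i < j -> n i < n j),
          basic_family T0 n fh
        & generates B Uc T0 n fh f].

Definition fubini_lim (W : set_system nat) (V : nat -> set_system nat) :
    set_system (nat * nat) :=
  [set A | W [set n | V n [set j | A (n, j)]]].

(* U is a family of subsets of the base set D, V of the base set E. *)
Definition isomorphic {T S : Type} (D : set T) (E : set S)
    (U : set_system T) (V : set_system S) : Prop :=
  exists2 g : T -> S, set_bij D E g &
    forall X, X `<=` E -> (V X <-> U (D `&` g @^-1` X)).

(* The closure of the nonprincipal p-points under Fubini products, each product
   being transported from nat * nat to nat along an arbitrary bijection. The
   derivations are the well-founded countably branching trees. *)
Inductive fubini_iteration : set_system nat -> Prop :=
| FubiniBase W : ppoint W -> nonprincipal W -> fubini_iteration W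
| FubiniLim W V U :
    fubini_iteration W -> (forall n, fubini_iteration (V n)) ->
    isomorphic [set: nat * nat] [set: nat] (fubini_lim W V) U ->
    fubini_iteration U.

(* Main.v *)
(** For each [n], each of the finitely many patterns [A] that a tree can have
    below [n] and each [j < n], fix a tree [S] with pattern [A] such that [j] is
    not in [f [S]], if there is one.  If [T0] is a tree and [n_k] a sequence of
    cutting points such that, for every [k], each such [S] for [n_k] contains
    the part of [T0] that extends [A] beyond [n_k], then monotonicity of [f]
    shows that [f [T]] below [k] is decided by [T] below [n_k], for all
    [T] contained in [T0].  Each p-point [U_c] provides a pseudo-intersection of
    the successor sets of [c] in the trees [S], whose finite errors at [n] are
    bounded by some [g n]; the cutting points are chosen such that the union of
    the blocks [[n_k, g n_k)] belongs to none of the countably many [U_c], so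
    that all these errors can be deleted.

    A Fubini product of trees over a front [B0] is represented on the front
    obtained by continuing each member [b] of [B0] with a copy, translated past
    [max b], of the front of the corresponding factor. *)

Require Import Defs.
From mathcomp Require Import all_boot finmap.
From mathcomp Require Import boolp classical_sets functions cardinality filter.
From mathcomp Require Import zify.

Set Implicit Arguments.
Unset Strict Implicit.
Unset Printing Implicit Defensive.

Local Open Scope classical_set_scope.

(** * Finite sets of naturals and their initial segments *)

Definition below (c : {fset nat}) (n : nat) : Prop :=
  forall x, x \in c -> x < n.

Lemma fmax_ge (a : {fset nat}) x : x \in a -> x <= fmax a.
Proof. by move=> xa; apply: (@leq_bigmax_seq _ _ xpredT id). Qed.

Lemma fmax_in (a : {fset nat}) : a <> fset0 -> fmax a \in a.
Proof.
move=> a0; apply/negPn/negP => na; apply: a0.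
have lt y : y \in a -> y < fmax a.
  by move=> ya; rewrite ltn_neqAle fmax_ge // andbT; apply: contraNneq na => <-.
have [->//|[x xa]] := fset_0Vmem a.
suff : fmax a < fmax a by rewrite ltnn.
have /prednK pE : 0 < fmax a by apply: leq_ltn_trans (lt x xa).
rewrite -[X in _ < X]pE ltnS; apply/bigmax_leqP_seq => y ya _.
by rewrite -ltnS pE lt.
Qed.

Lemma belowE c n : below c n <-> c = fset0 \/ fmax c < n.
Proof.
split=> [cn|[->//|cn x xc]].
- have [->|/eqP c0] := eqVneq c fset0; first by left.
  by right; apply: cn; apply: fmax_in.
- by apply: leq_ltn_trans cn; apply: fmax_ge.
Qed.

Lemma below_le c m n : m <= n -> below c m -> below c n.
Proof. by move=> mn cm x /cm xm; apply: leq_trans mn. Qed.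

Lemma below_fmax c : below c (fmax c).+1.
Proof. by move=> x /fmax_ge. Qed.

Lemma below_notin c n : below c n -> n \notin c.
Proof. by move=> cn; apply/negP => /cn; rewrite ltnn. Qed.

Lemma fmax_fset1U n c : below c n -> fmax (n |` c)%fset = n.
Proof.
move=> cn; apply/eqP; rewrite eqn_leq fmax_ge ?fset1U1 // andbT.
by apply/bigmax_leqP_seq => x; rewrite in_fset1U => /orP[/eqP->//|/cn/ltnW].
Qed.

Lemma finite_bounded (A : set nat) :
  finite_set A -> exists N, forall x, A x -> x < N.
Proof.
by move=> /finite_fsetP[X ->]; exists (fmax X).+1 => x /= /fmax_ge.
Qed.

Lemma bounded_finite (A : set nat) N : (forall x, A x -> x < N) -> finite_set A.
Proof. by move=> AN; apply: sub_finite_set (finite_II N) => x /AN. Qed.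

Lemma init_seg_refl (a : {fset nat}) : init_seg a [set` a].
Proof. by split. Qed.

Lemma init_seg0 X : init_seg fset0 X.
Proof. by split=> x //. Qed.

Lemma init_seg_trans a b X : init_seg a [set` b] -> init_seg b X -> init_seg a X.
Proof.
move=> [ab ia] [bX ib]; split=> [x /ab/bX//|x y Xx ya xy].
by apply: (ia _ _ _ ya xy); apply: ib Xx (ab _ ya) xy.
Qed.

Lemma init_seg_sub a (b : {fset nat}) X :
  init_seg a X -> [set` a] `<=` [set` b] -> [set` b] `<=` X ->
  init_seg a [set` b].
Proof. by move=> [_ ia] ab bX; split=> // x y /bX; apply: ia. Qed.

Lemma init_seg_total a b X :
  init_seg a X -> init_seg b X -> init_seg a [set` b] \/ init_seg b [set` a].
Proof.
move=> aX bX; have [ab|nab] := pselect ([set` a] `<=` [set` b]).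
  by left; exact: (init_seg_sub aX ab bX.1).
right; apply: (init_seg_sub bX) aX.1 => y yb.
have [x xa xb] : exists2 x, x \in a & x \notin b.
  by move/existsNP: nab => [x /not_implyP[xa /negP xb]]; exists x.
apply: (aX.2 y x) => //; first exact: bX.1.
rewrite leqNgt; apply: contra xb => xy.
by apply: (bX.2 x y) => //; [apply: aX.1|apply: ltnW].
Qed.

Lemma init_seg_anti a b : init_seg a [set` b] -> init_seg b [set` a] -> a = b.
Proof.
by move=> [ab _] [ba _]; apply/fsetP => x; apply/idP/idP => [/ab|/ba].
Qed.

Lemma init_seg_below a b n : init_seg a [set` b] -> below b n -> below a n.
Proof. by move=> [ab _] bn x /ab/bn. Qed.

Lemma init_seg_fset1U c n : below c n -> init_seg c [set` (n |` c)%fset].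
Proof.
move=> cn; split=> [x /= xc|x y /=]; first by rewrite in_fset1U xc orbT.
by rewrite in_fset1U => /orP[/eqP->|//] /cn; lia.
Qed.

Lemma init_seg_fset1U_inv s c n : below c n ->
  init_seg s [set` (n |` c)%fset] -> init_seg s [set` c] \/ s = (n |` c)%fset.
Proof.
move=> cn sc; have [ns|ns] := boolP (n \in s).
  right; apply/fsetP => x; apply/idP/idP => [/sc.1//|xc].
  apply: (sc.2 x n) => //; move: xc; rewrite in_fset1U.
  by move=> /orP[/eqP->//|/cn/ltnW].
left; apply: (init_seg_sub sc) (init_seg_fset1U cn).1 => x xs /=.
by move: (sc.1 _ xs); rewrite /= in_fset1U => /orP[/eqP xn|//]; rewrite -xn xs in ns.
Qed.

Lemma below_fsetD1_fmax t : below (t `\ fmax t)%fset (fmax t).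
Proof.
by move=> x; rewrite in_fsetD1 ltn_neqAle => /andP[-> /fmax_ge].
Qed.

Lemma fset1U_fsetD1_fmax t : t <> fset0 -> (fmax t |` (t `\ fmax t))%fset = t.
Proof. by move=> t0; apply: fsetD1K; apply: fmax_in. Qed.

Lemma fset1UD1_below c n : below c n -> ((n |` c) `\ n)%fset = c.
Proof. by move=> cn; apply: fsetU1K; apply: below_notin. Qed.

(** Elements are added in increasing order, so each inductive step passes from a node of a tree to
    one of its successors. *)
Lemma fset_max_ind (P : {fset nat} -> Prop) :
  P fset0 -> (forall c n, below c n -> P c -> P (n |` c)%fset) -> forall t, P t.
Proof.
move=> P0 PS t; have [k] := ubnP #|` t|; elim: k t => // k IH t tk.
have [->//|/eqP t0] := eqVneq t fset0.
rewrite -(fset1U_fsetD1_fmax t0); apply: PS; first exact: below_fsetD1_fmax.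
by apply: IH; move: tk; rewrite (cardfsD1 (fmax t)) fmax_in // add1n ltnS.
Qed.

(** * Fronts and their initial segments *)

Lemma hat_sub B b : B b -> hat B b.
Proof. by move=> Bb; exists b => //; apply: init_seg_refl. Qed.

Lemma hat_init B a b : hat B b -> init_seg a [set` b] -> hat B a.
Proof. by move=> [d Bd bd] ab; exists d => //; apply: init_seg_trans bd. Qed.

Lemma front_nonempty B : front B -> exists b, B b.
Proof. by move=> [_ /(_ _ infinite_nat)[b Bb _]]; exists b. Qed.

Lemma hat0 B : front B -> hat B fset0.
Proof. by move=> /front_nonempty[b Bb]; exists b => //; apply: init_seg0. Qed.

Lemma front_init_eq B a b : front B -> B a -> B b -> init_seg a [set` b] -> a = b.
Proof.
move=> [anti _] Ba Bb ab; apply: contrapT => neq; apply: (anti a b) => //.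
split=> // eab; apply: neq; apply/fsetP => x.
by move/seteqP: eab => [/(_ x) p /(_ x) q]; apply/idP/idP.
Qed.

Lemma front_hat_eq B a b : front B -> B a -> hat B b -> init_seg a [set` b] -> a = b.
Proof.
move=> fB Ba [d Bd bd] ab.
have ad : a = d by apply: (front_init_eq fB) => //; apply: init_seg_trans bd.
by apply: init_seg_anti => //; rewrite ad.
Qed.

Lemma hatm_fset1U B c n : front B -> below c n -> hat B (n |` c)%fset -> hatm B c.
Proof.
move=> fB cn hB; have ic := init_seg_fset1U cn.
split; first exact: hat_init hB ic.
move=> Bc; have /fsetP/(_ n) := front_hat_eq fB Bc hB ic.
by rewrite fset1U1 (negPf (below_notin cn)).
Qed.

(** The infinite set consisting of [c] and all numbers from [n] on has an initial segment [b] in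
    [B]. As [c] is in [hatm B], this [b] properly extends [c], and its first new element is [n]. *)
Lemma hat_fset1U B c n : front B -> hatm B c -> below c n -> hat B (n |` c)%fset.
Proof.
move=> fB [hc nBc] cn; pose X := [set x | x \in c \/ n <= x].
have infX : infinite_set X.
  move=> /finite_bounded[N NX]; have : X (n + N) by right; rewrite leq_addr.
  by move=> /NX; lia.
have [b Bb [bX _]] := fB.2 _ infX.
have cX : init_seg c X.
  split=> [x xc|x y]; first by left.
  by move=> [//|nx] /cn; lia.
have cb : init_seg c [set` b].
  have [//|bc] := init_seg_total cX bX.
  by case: nBc; rewrite -(front_hat_eq fB Bb hc bc).
exists b => //; apply: init_seg_sub bX.1.
- split=> [x /=|x y]; rewrite /= in_fset1U.
    by move=> /orP[/eqP->|xc]; [right|left].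
  rewrite in_fset1U; case=> [->|nx]; first by rewrite orbT.
  by move=> /orP[/eqP->|/cn yn] xy; apply/orP; left; apply/eqP; lia.
- move=> x /=; rewrite in_fset1U => /orP[/eqP->|/cb.1//].
  have [y yb yc] : exists2 y, y \in b & y \notin c.
    apply: contrapT => no; apply: nBc; suff <- : b = c by [].
    apply: init_seg_anti => //; apply: (init_seg_sub bX) cX.1 => y yb /=.
    by apply/negPn/negP => yc; apply: no; exists y.
  apply: (bX.2 n y) => //; first by right.
  by have [yc'|//] := bX.1 _ yb; rewrite yc' in yc.
Qed.

(** * Ultrafilters and trees *)

Lemma filter_meet (T : Type) (U : set_system T) (A B : set T) : ProperFilter U ->
  U A -> U B -> exists x, A x /\ B x.
Proof.
move=> pU UA UB; have UAB : U (A `&` B) by apply: filterI.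
by have [x] := filter_ex UAB; exists x.
Qed.

Lemma ultra_not (T : Type) (U : set_system T) (A : set T) : UltraFilter U ->
  ~ U A <-> U (~` A).
Proof.
move=> uU;
split=> [nA|nA UA]; first by case: (in_ultra_setVsetC A uU).
by have [x []] := filter_meet _ UA nA.
Qed.

Lemma nonprincipal_tail (U : set_system nat) N : UltraFilter U ->
  nonprincipal U -> U [set n | N <= n].
Proof.
move=> uU np; elim: N => [|N IH]; first exact: filterS filterT.
suff : U (~` [set N]).
  apply: filterS2 IH => x /= Nx xN; rewrite ltn_neqAle Nx andbT.
  by apply/eqP => /esym.
apply/ultra_not => // UN; apply: (np N); apply/seteqP; split=> A.
- by move=> UA y ->; have [x [Ax xN]] := filter_meet _ UA UN; rewrite -xN.
- by move=> AN; apply: filterS UN.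
Qed.

Lemma nonprincipal_below (U : set_system nat) c : UltraFilter U ->
  nonprincipal U -> U [set n | below c n].
Proof.
move=> uU np; apply: filterS (nonprincipal_tail (fmax c).+1 uU np) => n /= cn.
by apply: (below_le cn); apply: below_fmax.
Qed.

Definition nonprincipal_ppoints (B : set {fset nat})
    (Uc : {fset nat} -> set_system nat) : Prop :=
  forall c, hatm B c -> ppoint (Uc c) /\ nonprincipal (Uc c).

Definition tree_of (B : set {fset nat}) (Y : {fset nat} -> set nat) :
    set {fset nat} :=
  [set t | hat B t /\
     forall c n, below c n -> init_seg (n |` c)%fset [set` t] -> Y c n].

Lemma fset1U_below_inj c d m n : below c m -> below d n ->
  (m |` c)%fset = (n |` d)%fset -> m = n /\ c = d.
Proof.
move=> cm dn e; have mn : m = n by rewrite -(fmax_fset1U cm) e fmax_fset1U.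
by split=> //; rewrite -(fset1UD1_below cm) e mn fset1UD1_below.
Qed.

Lemma tree_of_utree B Uc Y : front B -> nonprincipal_ppoints B Uc ->
  (forall c, hatm B c -> Uc c (Y c)) -> utree B Uc (tree_of B Y).
Proof.
move=> fB pU UY; split.
- by move=> t [].
- move=> a b [hb Yb] ab; split=> [|c n cn ca]; first exact: hat_init hb ab.
  by apply: Yb => //; apply: init_seg_trans ab.
- split=> [|c n _ [/(_ n)]]; first exact: hat0.
  by rewrite /= fset1U1 => /(_ isT).
- move=> c [[hc Yc] hmc]; have [[uU _] np] := pU c hmc.
  apply: filterS2 (nonprincipal_below c uU np) (UY c hmc) => n cn Ycn.
  split=> [|d m dm dc]; first exact: hat_fset1U.
  have [|e] := init_seg_fset1U_inv cn dc; first exact: Yc.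
  by have [-> ->] := fset1U_below_inj dm cn e.
Qed.

Lemma hat_utree B Uc : front B -> nonprincipal_ppoints B Uc -> utree B Uc (hat B).
Proof.
move=> fB pU; split=> //; [by move=> a b; apply: hat_init|exact: hat0|].
move=> c [_ hmc]; have [[uU _] np] := pU c hmc.
by apply: filterS (nonprincipal_below c uU np) => n; apply: hat_fset1U.
Qed.

(** * Avoiding blocks, and diagonal trees *)

(* Halving the sequence of blocks once for each ultrafilter and diagonalising:
   of two interleaved halves at most one can belong to a given ultrafilter. *)
Lemma avoid_blocks (U : nat -> set_system nat) (g : nat -> nat) :
  exists a : nat -> nat, {homo a : i j / i < j} /\
    forall i, UltraFilter (U i) -> nonprincipal (U i) ->
      U i (~` [set x | exists k, a k <= x < g (a k)]).
Proof.
(* By this recursion [g (p i) <= p i.+1], so the blocks starting at the points [p i] are pairwise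
   disjoint. *)
pose p := fix p i := if i is j.+1 then maxn (p j).+1 (g (p j)) else 0.
have pS i : p i.+1 = maxn (p i).+1 (g (p i)) by [].
have p_lt : {homo p : i j / i < j}.
  by apply: homo_ltn ltn_trans _ => i; rewrite pS leq_max leqnn.
have p_le : {homo p : i j / i <= j} := ltnW_homo p_lt.
have gp i j : i < j -> g (p i) <= p j.
  by move=> /p_le; apply: leq_trans; rewrite pS leq_max leqnn orbT.
pose blk (e : nat -> nat) := [set x | exists k, p (e k) <= x < g (p (e k))].
(* The added boolean selects the odd-indexed half exactly when the blocks of the even-indexed half
   form a set in [U i]. *)
pose half i (e : nat -> nat) k :=
  e (k.*2 + `[< U i (blk (fun k => e k.*2)) >]).
have halfP i e : {homo e : i j / i < j} -> UltraFilter (U i) ->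
    U i (~` blk (half i e)).
  move=> elt uU; apply/ultra_not => //; rewrite /half.
  case: asboolP => [Ue Uo|nU]; last by under eq_fun do rewrite addn0.
  have [x [[k kx] [l lx]]] := filter_meet _ Ue Uo.
  move: kx lx => /andP[k1 k2] /andP[l1 l2].
  have [/elt/gp|/elt/gp] : k.*2 < l.*2 + true \/ l.*2 + true < k.*2 by lia.
    by lia.
  by lia.
pose es := fix es i := if i is j.+1 then half j (es j) else id.
have es_lt i : {homo es i : k l / k < l}.
  elim: i => [//|i IH] k l kl; apply: IH.
  by rewrite ltn_add2r ltn_double.
have es_sub i d k : exists l, es (d + i) k = es i l.
  elim: d k => [|d IH] k; first by exists k.
  exact: IH.
(* From index [i.+1] on, [E] takes its values among those of [es i.+1], which is [half i (es i)].
   The earlier blocks end before [p (E i.+1)], and a tail in [U i] discards them. *)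
pose E k := es k k.
have E_lt : {homo E : i j / i < j}.
  apply: homo_ltn ltn_trans _ => i; rewrite /E /= /half; apply: es_lt.
  by rewrite doubleS; lia.
exists (fun k => p (E k)); split=> [i j /E_lt/p_lt//|i uU np].
apply: filterS2 (halfP i (es i) (es_lt i) uU) (nonprincipal_tail (p (E i.+1)) uU np).
move=> x nx /= lex [k kx]; have [ki|ki] := leqP k i.
  have := gp _ _ (E_lt k i.+1 ki); move: kx; lia.
have [l El] := es_sub i.+1 (k - i.+1) k.
by apply: nx; exists l; move: kx; rewrite /E -{1 3}(subnK ki) El.
Qed.

Definition fset_iota n : {fset nat} := [fset i | i in iota 0 n]%fset.

Lemma in_fset_iota n x : (x \in fset_iota n) = (x < n).
Proof. by rewrite in_fset /= mem_iota. Qed.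

Definition subsets_below n : {fset {fset nat}} :=
  fpowerset (fset_iota n).

Lemma in_subsets_below n c : c \in subsets_below n <-> below c n.
Proof.
rewrite fpowersetE; split=> [/fsubsetP cn x /cn|cn].
  by rewrite in_fset_iota.
by apply/fsubsetP => x /cn; rewrite in_fset_iota.
Qed.

(** The p-points handle the nodes [c] below [a k], up to errors inside the avoided blocks. Any other
    node has [a k <= fmax c], which leaves finitely many sets [R n c] to intersect. *)
Lemma diagonal_tree B Uc (R : nat -> {fset nat} -> set nat) :
  front B -> nonprincipal_ppoints B Uc ->
  (forall n c, hatm B c -> Uc c (R n c)) ->
  exists (T0 : set {fset nat}) (a : nat -> nat),
    [/\ utree B Uc T0, {homo a : i j / i < j}
      & forall k c m, below c m -> T0 (m |` c)%fset -> a k <= m -> R (a k) c m].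
Proof.
move=> fB pU UR.
have /choice[ZG ZGP] (c : {fset nat}) : exists ZG : set nat * (nat -> nat),
    hatm B c -> Uc c ZG.1 /\ forall n m, ZG.1 m -> ZG.2 n <= m -> R n c m.
  have [hc|nhc] := pselect (hatm B c); last by exists (set0, id).
  have [[uU pp] _] := pU c hc.
  have [Z UZ fZ] := pp (R ^~ c) (fun n => UR n c hc).
  have /choice[G GP] n := finite_bounded (fZ n).
  exists (Z, G) => _; split=> // n m /= Zm Gm.
  by apply: contrapT => nR; have := GP n m (conj Zm nR); rewrite ltnNge Gm.
pose g n := \max_(c <- subsets_below n) (ZG c).2 n.
(* Codes of no finite set get the empty system, which is not an ultrafilter, so [avoid_blocks]
   asserts nothing about them. *)
pose U i := if choice.unpickle i is Some c then Uc c else set0.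
have [a [a_lt aP]] := avoid_blocks U g.
pose Y c := (ZG c).1 `&` [set m | forall n, n <= fmax c -> R n c m] `&`
            ~` [set x | exists k, a k <= x < g (a k)].
exists (tree_of B Y), a; split=> //.
- apply: tree_of_utree => // c hc; have [[uU _] np] := pU c hc.
  apply: filterI; last by have := aP (choice.pickle c); rewrite /U choice.pickleK; apply.
  apply: filterI; first by have [] := ZGP c hc.
  have : Uc c (\bigcap_(n in [set` fset_iota (fmax c).+1]) R n c).
    by apply: filter_bigI => n _; apply: UR.
  by apply: filterS => m Rm n nc; apply: Rm; rewrite /= in_fset_iota.
- move=> k c m cm [hcm /(_ c m cm (init_seg_refl _))[[Zm Rm] nm]] akm.
  have hc := hatm_fset1U fB cm hcm; have [_ GP] := ZGP c hc.
  have [cak|ncak] := pselect (below c (a k)).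
    apply: GP => //; apply: (@leq_trans (g (a k))).
      by apply: (@leq_bigmax_seq _ _ xpredT (fun c => (ZG c).2 (a k))) => //;
        apply/in_subsets_below.
    by rewrite leqNgt; apply/negP => mg; apply: nm; exists k; rewrite akm.
  apply: Rm; rewrite leqNgt; apply/negP => lt; apply: ncak.
  by apply/belowE; right.
Qed.

(** * Basic Tukey reductions over a front *)

Definition extension (T0 A : set {fset nat}) (n : nat) : set {fset nat} :=
  [set t | T0 t /\
     forall s, init_seg s [set` t] -> below s n -> s = fset0 \/ A s].

(** Adding some [m >= n] to a node creates no new initial segment below [n]. Hence [A] can only
    remove successors with [m < n], finitely many at each node. *)
Lemma extension_utree B Uc T0 A n : nonprincipal_ppoints B Uc ->
  utree B Uc T0 -> utree B Uc (extension T0 A n).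
Proof.
move=> pU [T0B T0d T00 T0U]; split.
- by move=> t [/T0B].
- move=> a b [T0b eb] ab; split=> [|s sa]; first exact: T0d T0b ab.
  by apply: eb; apply: init_seg_trans ab.
- by split=> // s s0 _; left; apply: init_seg_anti => //; apply: init_seg0.
- move=> c [[T0c ec] hc]; have [[uU _] np] := pU c hc.
  have cU := nonprincipal_below c uU np; have nU := nonprincipal_tail n uU np.
  apply: filterS3 cU nU (T0U c (conj T0c hc)) => m cm /= nm T0m.
  split=> // s /(init_seg_fset1U_inv cm)[|->]; first exact: ec.
  by move=> /(_ m); rewrite fset1U1 => /(_ isT); lia.
Qed.

Lemma generated_branches B Uc T : utree B Uc T -> generated B Uc (branches B T).
Proof. by move=> uT; split=> [t []//|]; exists T. Qed.

Lemma utree_sub_extension B Uc T0 T n : utree B Uc T -> T `<=` T0 ->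
  T `<=` extension T0 (restr T n) n.
Proof.
move=> [_ Td _ _] TT0 t Tt; split=> [|s st sn]; first exact: TT0.
right; split; first exact: Td Tt st.
exact/belowE.
Qed.

Definition pattern n (S : set {fset nat}) : {fset {fset nat}} :=
  [fset c in subsets_below n | `[< S c >]]%fset.

Lemma in_pattern n S c : c \in pattern n S <-> below c n /\ S c.
Proof.
rewrite !inE; split=> [/andP[/in_subsets_below cn /asboolP]//|[cn Sc]].
by apply/andP; split; [apply/in_subsets_below|apply/asboolP].
Qed.

Lemma front_basic_Tukey B Uc : front B -> nonprincipal_ppoints B Uc ->
  basic_Tukey_reductions B Uc.
Proof.
move=> fB pU V f _ _ fmono _.
have fS S T j : utree B Uc S -> utree B Uc T -> S `<=` T ->
    f (branches B S) j -> f (branches B T) j.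
  move=> uS uT ST; apply: fmono; try exact: generated_branches.
  by move=> t [/ST Tt Bt].
(* [St (n, A, j)] is a tree with pattern [A] below [n] whose image omits [j], provided one exists;
   otherwise it is [hat B]. *)
have /choice[St StP] (q : nat * {fset {fset nat}} * nat) : exists S,
    utree B Uc S /\ forall T, utree B Uc T -> pattern q.1.1 T = q.1.2 ->
      ~ f (branches B T) q.2 -> pattern q.1.1 S = q.1.2 /\ ~ f (branches B S) q.2.
  have [[T [uT pT fT]]|no] := pselect (exists T, [/\ utree B Uc T,
      pattern q.1.1 T = q.1.2 & ~ f (branches B T) q.2]).
    by exists T; split.
  exists (hat B); split=> [|T uT pT fT]; first exact: hat_utree.
  by case: no; exists T.
(* Finitely many pairs [A], [j] occur, so the successors retained by all the trees [St (n, A, j)]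
   containing [c] form a set in [Uc c]. *)
pose R n c := \bigcap_(A in [set` fpowerset (subsets_below n)])
  \bigcap_(j in [set` fset_iota n])
    [set m | St (n, A, j) c -> St (n, A, j) (m |` c)%fset].
have UR n c : hatm B c -> Uc c (R n c).
  move=> hc; have [[uU _] _] := pU c hc.
  apply: filter_bigI => A _; apply: filter_bigI => j _.
  have [[_ _ _ StU] _] := StP (n, A, j).
  have [Sc|nSc] := pselect (St (n, A, j) c); last by apply: filterS filterT => m _.
  by apply: filterS (StU c (conj Sc hc)) => m Sm _.
have [T0 [a [uT0 a_lt aR]]] := diagonal_tree fB pU UR.
(* This puts every [j < k] among the [j < a k] covered by [R (a k)]. *)
have ak k : k <= a k.
  by elim: k => // k IH; apply: leq_ltn_trans IH (a_lt _ _ (ltnSn k)).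
have uE A k : utree B Uc (extension T0 A (a k)) by apply: extension_utree.
(* Otherwise [St] for the pattern of [T] omits [j] as well. By induction on nodes it contains the
   extension: below [a k] the patterns agree, and from [a k] on [aR] supplies the successors. This
   contradicts monotonicity of [f]. *)
have key T k j : utree B Uc T -> T `<=` T0 -> j < k ->
    f (branches B (extension T0 (restr T (a k)) (a k))) j -> f (branches B T) j.
  move=> uT TT0 jk fE; apply: contrapT => nfT.
  have [uS /(_ T uT erefl nfT)/=[pS nfS]] := StP (a k, pattern (a k) T, j).
  apply: nfS; apply: fS fE => // {uE}; elim/fset_max_ind => [|c m cm IH] Et.
    by case: uS.
  have [ma|am] := ltnP m (a k).
    have /in_pattern[] // :
        (m |` c)%fset \in pattern (a k) (St (a k, pattern (a k) T, j)).
    rewrite pS; apply/in_pattern.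
    have bm : below (m |` c)%fset (a k).
      by move=> x; rewrite in_fset1U => /orP[/eqP->//|/cm]; lia.
    split=> //; have [e|[]//] := Et.2 _ (init_seg_refl _) bm.
    by move/fsetP/(_ m): e; rewrite fset1U1.
  have [T0t et] := Et; have := aR k c m cm T0t am.
  move/(_ (pattern (a k) T)); apply.
  - by rewrite /= fpowersetE; apply/fsubsetP => s; rewrite !inE => /andP[].
  - by rewrite /= in_fset_iota; apply: leq_trans jk (ak k).
  - apply: IH; have [_ + _ _] := extension_utree (restr T (a k)) (a k) pU uT0.
    by apply; [exact: Et|exact: init_seg_fset1U].
(* An arbitrary [A] is evaluated at the largest subtree of [T0] that [A] allows below [a k], so
   monotonicity of [f] carries over. *)
exists T0, a, (fun k A => [set j | j < k /\ f (branches B (extension T0 A (a k))) j]).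
split=> //.
- split.
  + by move=> k A _ j [].
  + move=> k m A km Am; pose T := extension T0 A (a m).
    have TT0 : T `<=` T0 by move=> t [].
    (* Cutting the tree at [a k] and extending again drops the constraints of [A] from [a k] on.
       Then [key] and [utree_sub_extension] give the two inclusions. *)
    have e : extension T0 (restr T (a k)) (a k) = extension T0 (restr A (a k)) (a k).
      have akm := ltnW (a_lt _ _ km).
      apply/seteqP; split=> t [T0t et]; split=> // s st sn;
        have [->|] := et s st sn; auto.
        move=> [[_ es] _]; have [->|As] := es s (init_seg_refl s) (below_le akm sn).
          by left.
        by right; split=> //; apply/belowE.
      move=> [As _]; right; split; last exact/belowE.
      split; first by case: uT0 => _ T0d _ _; apply: T0d T0t st.
      move=> r rs _.
      have [|[Ar _]] := et r (init_seg_trans rs st) (init_seg_below rs sn).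
        by left.
      by right.
    apply/seteqP; split=> j.
    * move=> [jk]; rewrite -e => /(key _ _ _ (uE A m) TT0 jk) fj.
      by split=> //; split=> //; apply: ltn_trans km.
    * move=> [[_ fj] jk]; split=> //; rewrite -e.
      by apply: fS fj => //; apply: utree_sub_extension.
  + move=> k A A' AA' _ j [jk fj]; split=> //; apply: fS fj => // t [T0t et].
    by split=> // s st sn; have [->|/AA'] := et s st sn; auto.
- move=> T uT TT0; apply/seteqP; split=> j.
  + move=> fj; exists j.+1 => //; split=> //=.
    by apply: fS fj => //; exact: utree_sub_extension uT TT0.
  + by move=> [k _ [jk]]; apply: key.
Qed.

(** * Flat fronts *)

(* Unlike [flat_top_front], which it implies, this passes to [front_sum] without
   a case distinction on the size of the members. *)
Definition flat_front (B : set {fset nat}) : Prop :=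
  [/\ front B, ~ B fset0
    & forall b n, B b -> below (b `\ fmax b)%fset n ->
        B (n |` (b `\ fmax b))%fset].

Lemma init_seg_min a : a <> fset0 -> exists n, init_seg [fset n]%fset [set` a].
Proof.
elim/fset_max_ind: a => [//|c n cn IH] _.
have [->|/eqP/IH[m mc]] := eqVneq c fset0.
  by exists n; rewrite fsetU0; apply: init_seg_refl.
by exists m; apply: init_seg_trans mc (init_seg_fset1U cn).
Qed.

Lemma fsetD1_fmax_card1 (b : {fset nat}) : #|` b| = 1 -> (b `\ fmax b)%fset = fset0.
Proof.
move=> /eqP/cardfs1P[n ->]; have /fset1P-> : fmax [fset n]%fset \in [fset n]%fset.
  by apply: fmax_in => /fsetP/(_ n); rewrite !inE eqxx.
by apply/fsetP => x; rewrite !inE andNb.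
Qed.

Lemma fsetD1_fmax_neq0 (b : {fset nat}) : 2 <= #|` b| -> (b `\ fmax b)%fset <> fset0.
Proof.
by move=> b2 e; move: b2; rewrite (cardfsD1 (fmax b)) e cardfs0; case: (_ \in _).
Qed.

(** If some member is a singleton, exchanging its maximum makes every singleton a member, and no
    other member can then exist. Otherwise, for a member [c] extending [a], adding to [a] the least
    element of [c] outside [a] gives a member that is an initial segment of [c], hence [c]
    itself. *)
Lemma flat_front_flat_top B : flat_front B -> flat_top_front B.
Proof.
move=> [fB B0 Btop]; split=> //; first by move=> e; apply: B0; rewrite e.
have [[b Bb b1]|no] := pselect (exists2 b, B b & #|` b| = 1).
  left; have B1 n : B [fset n]%fset.
    by have := Btop b n Bb; rewrite fsetD1_fmax_card1 // fsetU0; apply.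
  apply/seteqP; split=> [a Ba|a /= /eqP/cardfs1P[n ->]//].
  have [|n na] := @init_seg_min a; first by move=> e; rewrite e in Ba.
  by rewrite -(front_init_eq fB (B1 n) Ba na) /= cardfs1.
have B2 b : B b -> 2 <= #|` b|.
  move=> Bb; case e : #|` b| => [|[|//]]; last by case: no; exists b.
  by move/eqP: e; rewrite cardfs_eq0 => /eqP e; rewrite e in Bb.
right; split=> // b Bb a.
(* Nonemptiness makes [fmax a < n] equivalent to [below a n]: for the empty set they differ at
   [n = 0], because [fmax fset0] is [0]. *)
have a0 : a <> fset0 by apply: fsetD1_fmax_neq0; apply: B2.
have aB n : below a n -> B (n |` a)%fset by apply: Btop.
clearbody a; apply/seteqP; split=> [_ [c [Bc [ac nac]] <-]|_ [n an <-]].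
- have [|n nc] := @init_seg_min (c `\` a)%fset.
    move=> e; apply: nac; apply/seteqP; split; first exact: ac.1.
    move=> x xc; apply/negPn/negP => xa.
    by move/fsetP/(_ x): e; rewrite inE xa xc.
  have /= := nc.1 n; rewrite !inE eqxx => /(_ isT)/andP[na nc'].
  have an : below a n.
    by move=> x xa; rewrite ltnNge; apply: contra na => nx; apply: (ac.2 n x).
  suff <- : (n |` a)%fset = c.
    exists n; first by rewrite /=; have /belowE[] := an.
    by apply/fsetP => x; rewrite !inE; case: eqVneq => [->|]; rewrite ?(negPf na) ?andNb.
  apply: (front_init_eq fB) => //; first exact: aB.
  split=> [x /=|x y xc /=]; rewrite !inE.
    by move=> /orP[/eqP->//|/ac.1].
  move=> /orP[/eqP-> xn|ya xy]; last by rewrite (ac.2 x y) ?orbT.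
  apply/orP; have [|xa] := boolP (x \in a); [by right|left].
  have := nc.2 x n; rewrite /= !inE xa eqxx; exact.
- have ban : below a n by apply/belowE; right.
  exists (n |` a)%fset; first split; first exact: aB.
    split=> [|/seteqP[_ /(_ n)]]; first exact: init_seg_fset1U.
    by rewrite /= fset1U1 (negPf (below_notin ban)) => /(_ isT).
  apply/fsetP => x; rewrite !inE; case: eqVneq => [->|]; last by rewrite andNb.
  by rewrite (below_notin ban).
Qed.

(** * Gluing of finite sets *)

(* [c] is translated past [max b], so that [b] is an initial segment of
   [glue b c]. *)
Definition glue (b c : {fset nat}) : {fset nat} :=
  (b `|` [fset (x + (fmax b).+1)%N | x in c])%fset.

Lemma in_glue_shift b c x : (x + (fmax b).+1 \in glue b c) = (x \in c).
Proof.
rewrite in_fsetU; have /negPf-> : x + (fmax b).+1 \notin b.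
  by apply/negP => /fmax_ge; lia.
apply/imfsetP/idP => /= [[y yc /addIn->//]|xc]; by exists x.
Qed.

Lemma in_glueP b c y :
  y \in glue b c <-> y \in b \/ exists2 x, x \in c & y = x + (fmax b).+1.
Proof.
rewrite in_fsetU; split=> [/orP[|/imfsetP[x/=]]|[->//|[x xc ->]]].
- by left.
- by right; exists x.
- by apply/orP; right; apply/imfsetP; exists x.
Qed.

Lemma glue0 b : glue b fset0 = b.
Proof.
by apply/fsetP => x; apply/idP/idP => [/in_glueP[//|[]//]|xb]; apply/in_glueP; left.
Qed.

Lemma glue_inj b : injective (glue b).
Proof.
move=> c d e; apply/fsetP => x.
by rewrite -(in_glue_shift b c) e in_glue_shift.
Qed.

Lemma glue_fset1U b c x :
  glue b (x |` c)%fset = ((x + (fmax b).+1)%N |` glue b c)%fset.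
Proof.
apply/fsetP => y; rewrite in_fset1U; apply/idP/orP.
- move=> /in_glueP[yb|[z]]; first by right; apply/in_glueP; left.
  rewrite in_fset1U => /orP[/eqP->|zc] ->; first by left.
  by right; rewrite in_glue_shift.
- move=> [/eqP->|/in_glueP[yb|[z zc ->]]]; rewrite ?in_glue_shift ?fset1U1 //.
    by apply/in_glueP; left.
  by rewrite in_fset1U zc orbT.
Qed.

(** Up to [fmax b] the set [X] agrees with [b], and beyond it only the translated copy matters. Were
    [b] empty, the shift would be by [1] and could skip an element [0] of [X]. *)
Lemma init_seg_glue b c (X : set nat) : b <> fset0 -> init_seg b X ->
  init_seg c [set x | X (x + (fmax b).+1)] -> init_seg (glue b c) X.
Proof.
move=> b0 bX cX; split=> [y /in_glueP[/bX.1//|[x /cX.1/= Xx ->]//]|x y Xx].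
have bmem : x <= fmax b -> x \in b by apply: bX.2 => //; apply: fmax_in.
have [/bmem xb _ _|xb] := leqP x (fmax b); first by apply/in_glueP; left.
rewrite -(subnK xb) in Xx *; move=> /in_glueP[/fmax_ge|[z zc ->]]; first by lia.
by rewrite in_glue_shift leq_add2r => ?; apply: (cX.2 _ z).
Qed.

Lemma init_seg_glueL b c : init_seg b [set` glue b c].
Proof.
split=> [x xb|x y /in_glueP[//|[z _ ->]] /fmax_ge]; last by lia.
by apply/in_glueP; left.
Qed.

Lemma init_seg_glueR b c d : b <> fset0 ->
  init_seg (glue b c) [set` glue b d] <-> init_seg c [set` d].
Proof.
move=> b0; split=> [[cd icd]|cd].
- split=> [x xc|x y xd yc xy].
    by have := cd (x + (fmax b).+1); rewrite /= !in_glue_shift; apply.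
  have := icd (x + (fmax b).+1) (y + (fmax b).+1).
  by rewrite /= !in_glue_shift leq_add2r; apply.
- apply: init_seg_glue (init_seg_glueL b d) _ => //.
  suff -> : [set x | [set` glue b d] (x + (fmax b).+1)] = [set` d] by [].
  by apply/seteqP; split=> x; rewrite /= in_glue_shift.
Qed.

Lemma init_seg_glue_inv a b c : init_seg a [set` glue b c] ->
  init_seg a [set` b] \/ exists2 d, init_seg d [set` c] & a = glue b d.
Proof.
move=> ac; have [|ba] := init_seg_total ac (init_seg_glueL b c); first by left.
right; exists [fset x in c | (x + (fmax b).+1)%N \in a]%fset.
- split=> [x /=|x y xc]; rewrite !inE; first by case/andP.
  move=> /andP[yc ya] xy; apply/andP; split=> //.
  by apply: ac.2 ya _; rewrite /= ?in_glue_shift // leq_add2r.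
- apply/fsetP => y; apply/idP/idP => [ya|/in_glueP[/ba.1//|[x]]].
    apply/in_glueP; have /in_glueP[yb|[x xc e]] := ac.1 _ ya; first by left.
    by right; exists x => //; rewrite !inE /= xc -e ya.
  by rewrite !inE => /andP[_ ?] ->.
Qed.

Lemma below_glue b c x : below c x -> below (glue b c) (x + (fmax b).+1).
Proof. by move=> cx y /in_glueP[/fmax_ge|[z /cx + ->]]; lia. Qed.

Lemma below_glue_inv b c n : b <> fset0 -> below (glue b c) n ->
  exists2 x, below c x & n = x + (fmax b).+1.
Proof.
move=> b0 bn; have nb : fmax b < n by apply/bn/in_glueP; left; apply: fmax_in.
exists (n - (fmax b).+1); last by rewrite subnK.
by move=> x xc; have := bn (x + (fmax b).+1); rewrite in_glue_shift => /(_ xc); lia.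
Qed.

(** * Translated p-points and sums of fronts *)

(** The image of [U] under adding [s]: the successors of [glue b c] come from those of [c] by adding
    [(fmax b).+1]. *)
Definition shift_filter (U : set_system nat) (s : nat) : set_system nat :=
  [set X | U [set x | X (x + s)]].

Lemma shift_ppoint U s : ppoint U -> ppoint (shift_filter U s).
Proof.
move=> [uU pp]; split.
- have pS : ProperFilter (shift_filter U s).
    exact: (fmap_proper_filter (addn^~ s) (ultra_proper (UltraFilter := uU))).
  split=> // G pG SG; apply/seteqP; split=> // A GA; apply: contrapT => nA.
  have : G (~` A) by apply: SG; apply/(ultra_not [set x | A (x + s)] uU).
  by move=> /(filter_meet _ GA)[x []].
- move=> X SX; have [Y UY fY] := pp (fun n => [set x | X n (x + s)]) SX.
  exists ((addn^~ s) @` Y) => [|n].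
    by apply: (@filterS _ U _ Y) => // x Yx; exists x.
  apply: sub_finite_set (finite_image (addn^~ s) (fY n)) => _ [[x Yx <-] nX].
  by exists x.
Qed.

Lemma shift_nonprincipal U s : UltraFilter U -> nonprincipal U ->
  nonprincipal (shift_filter U s).
Proof.
move=> uU np x e.
have Ux : U [set y | y + s = x].
  by have : shift_filter U s [set x] by rewrite e; apply/principal_filterP.
have [y [/= xy yx]] := filter_meet _ (nonprincipal_tail x.+1 uU np) Ux.
by move: xy; rewrite -yx; lia.
Qed.

Definition front_sum (B0 : set {fset nat}) (C : {fset nat} -> set {fset nat}) :
    set {fset nat} :=
  [set t | exists b c, [/\ B0 b, C b c & t = glue b c]].

(** A member [b] of [B0] is no longer maximal in the sum: as [glue b fset0] it takes the shifted
    ultrafilter of the root of [C b]. Over a flat front [B0] the two clauses exclude each other. *)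
Definition sum_ultrafilters (B0 : set {fset nat})
    (C : {fset nat} -> set {fset nat}) (U0 : {fset nat} -> set_system nat)
    (U : {fset nat} -> {fset nat} -> set_system nat) :
    {fset nat} -> set_system nat :=
  fun t => [set X | (hatm B0 t /\ U0 t X) \/
    exists b c, [/\ B0 b, hatm (C b) c, t = glue b c
                  & shift_filter (U b c) (fmax b).+1 X]].

Section FrontSum.
Context (B0 : set {fset nat}) (C : {fset nat} -> set {fset nat}).
Context (fB0 : flat_front B0) (fC : forall b, B0 b -> flat_front (C b)).
Let B := front_sum B0 C.

Let frB0 : front B0. Proof. by case: fB0. Qed.

Let frC b : B0 b -> front (C b). Proof. by move=> /fC[]. Qed.

Let B0_neq0 b : B0 b -> b <> fset0.
Proof. by move=> Bb b0; case: fB0 => _ + _; rewrite -b0. Qed.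

Let C_neq0 b c : B0 b -> C b c -> c <> fset0.
Proof. by move=> Bb Cc c0; case: (fC Bb) => _ + _; rewrite -c0. Qed.

Let B0_comparable b b' X :
  B0 b -> B0 b' -> init_seg b X -> init_seg b' X -> b = b'.
Proof.
move=> Bb Bb' bX b'X; have [i|i] := init_seg_total bX b'X.
  exact: front_init_eq frB0 Bb Bb' i.
exact/esym/(front_init_eq frB0 Bb' Bb i).
Qed.

Lemma glue_uniq b b' c c' :
  B0 b -> B0 b' -> glue b c = glue b' c' -> b = b' /\ c = c'.
Proof.
move=> Bb Bb' e; have bb : b = b'.
  apply: (B0_comparable Bb Bb' (init_seg_glueL b c)).
  by rewrite e; apply: init_seg_glueL.
by split=> //; apply: (@glue_inj b); rewrite e bb.
Qed.

Let glue_hat b c : B0 b -> hat B0 (glue b c) -> c = fset0.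
Proof.
move=> Bb hc; apply: (@glue_inj b); rewrite glue0.
exact/esym/(front_hat_eq frB0 Bb hc (init_seg_glueL b c)).
Qed.

Lemma hat_front_sum t : hat B t <->
  hat B0 t \/ exists b c, [/\ B0 b, hat (C b) c & t = glue b c].
Proof.
split=> [[_ [b [c [Bb Cc ->]]] /init_seg_glue_inv[tb|[d dc ->]]]|].
- by left; exists b.
- by right; exists b, d; split=> //; exists c.
- move=> [[b Bb tb]|[b [c [Bb [d Cd cd] ->]]]].
    have [c Cc] := front_nonempty (frC Bb).
    exists (glue b c); first by exists b, c.
    exact: init_seg_trans tb (init_seg_glueL b c).
  exists (glue b d); first by exists b, d.
  by apply/init_seg_glueR => //; apply: B0_neq0.
Qed.

Lemma hatm_front_sum t : hatm B t <->
  hatm B0 t \/ exists b c, [/\ B0 b, hatm (C b) c & t = glue b c].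
Proof.
split.
- move=> [/hat_front_sum[ht|[b [c [Bb hc ->]]]] nBt]; last first.
    right; exists b, c; split=> //; split=> // Cc.
    by apply: nBt; exists b, c.
  have [Bt|nt] := pselect (B0 t); last by left.
  (* A member [t] of [B0] is [glue t fset0], and [fset0] lies in [hatm (C t)] because the flat front
     [C t] omits it. *)
  right; exists t, fset0; rewrite glue0; split=> //.
  by split; [apply: hat0; apply: frC|case: (fC Bt)].
- move=> [[ht nt]|[b [c [Bb [hc nc] ->]]]].
    split; first by apply/hat_front_sum; left.
    move=> [b [c [Bb Cc e]]]; apply: (C_neq0 Bb Cc).
    by apply: (glue_hat Bb); rewrite -e.
  split; first by apply/hat_front_sum; right; exists b, c.
  by move=> [b' [c' [Bb' Cc' /(glue_uniq Bb Bb')[eb ec]]]]; apply: nc; rewrite eb ec.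
Qed.

(** An infinite [X] first yields [b] in [B0]; then its part past [fmax b], shifted down, yields [c]
    in [C b]. The maximum of [glue b c] is that of [c] shifted, so exchanging it takes place inside
    [C b]. *)
Lemma front_sum_flat : flat_front B.
Proof.
split.
- split=> [_ _ [b [c [Bb Cc ->]]] [b' [c' [Bb' Cc' ->]]] [i ni]|X iX].
    have bb : b = b'.
      apply: (B0_comparable Bb Bb' _ (init_seg_glueL b' c')).
      exact: init_seg_trans (init_seg_glueL b c) i.
    move: i ni Cc'; rewrite -bb => /(init_seg_glueR _ _ (B0_neq0 Bb)) i ni Cc'.
    by apply: ni; rewrite (front_init_eq (frC Bb) Cc Cc' i).
  have [b Bb [bX _]] := frB0.2 _ iX.
  have iX' : infinite_set [set x | X (x + (fmax b).+1)].
    move=> /finite_bounded[N XN]; apply: iX.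
    apply: (@bounded_finite _ (N + (fmax b).+1)) => x Xx.
    have [|xb] := leqP x (fmax b); first by lia.
    by rewrite -(subnK xb) ltn_add2r; apply: XN; rewrite /= subnK.
  have [c Cc [cX _]] := (frC Bb).2 _ iX'.
  exists (glue b c); first by exists b, c.
  split; first exact: init_seg_glue (B0_neq0 Bb) bX cX.
  by move=> e; apply: iX; rewrite -e.
- move=> [b [c [Bb Cc e]]]; apply: (B0_neq0 Bb).
  by apply: init_seg_anti (init_seg0 _); rewrite e; apply: init_seg_glueL.
- move=> _ n [b [c [Bb Cc ->]]].
  have c0 := C_neq0 Bb Cc; have cE := fset1U_fsetD1_fmax c0.
  have := below_fsetD1_fmax (t := c); move: cE.
  set m := fmax c; set e := (c `\ m)%fset => cE em.
  have gm := below_glue (b := b) em.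
  rewrite -cE glue_fset1U fmax_fset1U // fset1UD1_below //.
  move=> /(below_glue_inv (B0_neq0 Bb))[x ex ->]; rewrite -glue_fset1U.
  exists b, (x |` e)%fset; split=> //.
  by have [_ _] := fC Bb; apply.
Qed.

Context (U0 : {fset nat} -> set_system nat).
Context (U : {fset nat} -> {fset nat} -> set_system nat).
Context (pU0 : nonprincipal_ppoints B0 U0).
Context (pU : forall b, B0 b -> nonprincipal_ppoints (C b) (U b)).
Let Us := sum_ultrafilters B0 C U0 U.

Let UsL t : hatm B0 t -> Us t = U0 t.
Proof.
move=> ht; apply/seteqP; split=> X; last by left.
move=> [[]//|[b [c [Bb hc e _]]]]; case: (ht) => h [].
by move: e h => -> /(glue_hat Bb)->; rewrite glue0.
Qed.

Let UsR b c : B0 b -> hatm (C b) c ->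
  Us (glue b c) = shift_filter (U b c) (fmax b).+1.
Proof.
move=> Bb hc; apply/seteqP; split=> X; last by right; exists b, c.
move=> [[[/(glue_hat Bb)-> []]]|[b' [c' [Bb' hc' e]]]]; first by rewrite glue0.
by have [-> ->] := glue_uniq Bb Bb' e.
Qed.

Lemma sum_ultrafilters_ppoints : nonprincipal_ppoints B Us.
Proof.
move=> t /hatm_front_sum[ht|[b [c [Bb hc ->]]]]; first by rewrite UsL //; apply: pU0.
have [pp np] := pU Bb hc; rewrite UsR //.
by split; [apply: shift_ppoint|apply: shift_nonprincipal => //; case: pp].
Qed.

(** A tree on the sum splits into its trace on [hat B0] and, above each branch [b], a tree on [C b];
    conversely, trees chosen above the branches of a tree on [B0] are glued onto it. This is how a
    Fubini limit is read off a single front. *)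
Lemma generated_front_sum X : X `<=` B ->
  generated B Us X <->
  generated B0 U0 [set b | B0 b /\
    generated (C b) (U b) [set c | C b c /\ X (glue b c)]].
Proof.
move=> XB; split=> [[_ [T [TB Td T0 TU] TX]]|[_ [T uT TX]]].
- split=> [b []//|]; exists (T `&` hat B0).
    split=> [t []//|a b [Tb hb] ab|//|].
    + by split; [apply: Td Tb ab|apply: hat_init hb ab].
    + by split=> //; apply: hat0.
    + move=> c [[Tc _] hc]; have [[uU _] np] := pU0 hc.
      have hBc : hatm B c by apply/hatm_front_sum; left.
      have := TU c (conj Tc hBc); rewrite UsL // => UT.
      apply: filterS2 UT (nonprincipal_below c uU np) => n Tn cn.
      by split=> //; apply: hat_fset1U.
  move=> b [[Tb _] Bb]; split=> //; split=> [c []//|].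
  exists [set c | hat (C b) c /\ T (glue b c)]; last first.
    move=> c [[_ Tc] Cc]; split=> //; apply: TX; split=> //.
    by exists b, c.
  split=> [c []//|c d [hd Td'] cd||c [[_ Tc] hc]].
  + split; first exact: hat_init hd cd.
    by apply: Td Td' _; apply/init_seg_glueR => //; apply: B0_neq0.
  + by split; [apply: hat0; apply: frC|rewrite glue0].
  + have [[uU _] np] := pU Bb hc.
    have hBc : hatm B (glue b c) by apply/hatm_front_sum; right; exists b, c.
    have UT : U b c [set n | T ((n + (fmax b).+1)%N |` glue b c)%fset].
      by have := TU _ (conj Tc hBc); rewrite UsR.
    apply: filterS2 UT (nonprincipal_below c uU np) => n Tn cn.
    split; first by apply: hat_fset1U => //; apply: frC.
    by rewrite glue_fset1U.
- split=> //; have [TB Td T0 TU] := uT.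
  have /choice[S SP] b : exists S, branches B0 T b ->
      utree (C b) (U b) S /\
      branches (C b) S `<=` [set c | C b c /\ X (glue b c)].
    have [/TX[_ [_ [S uS SX]]]|nb] := pselect (branches B0 T b); last by exists set0.
    by exists S.
  pose T' := T `|` [set t | exists b c, [/\ branches B0 T b, S b c & t = glue b c]].
  exists T'.
    split.
    + move=> t [/TB ht|[b [c [Tb Sc ->]]]]; apply/hat_front_sum; first by left.
      have [[SB _ _ _] _] := SP b Tb.
      by right; exists b, c; split; [case: Tb|apply: SB|].
    + move=> a t [Tt at_|[b [c [Tb Sc ->]]] /init_seg_glue_inv[ab|[d dc ->]]].
      * by left; apply: Td at_.
      * by left; apply: Td ab; case: Tb.
      * have [[_ Sd _ _] _] := SP b Tb.
        by right; exists b, d; split=> //; apply: Sd dc.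
    + by left.
    + have UT' b c : branches B0 T b -> S b c -> hatm (C b) c ->
          Us (glue b c) [set n | T' (n |` glue b c)%fset].
        move=> Tb Sc hc; have Bb := Tb.2; have [[uU _] _] := pU Bb hc.
        have [[_ _ _ SU] _] := SP b Tb; rewrite UsR //.
        apply: (@filterS _ (U b c) _ _ _ _ (SU c (conj Sc hc))) => n /= Sn; right.
        by exists b, (n |` c)%fset; rewrite glue_fset1U.
      move=> t [[Tt|[b [c [Tb Sc ->]]]] /hatm_front_sum[ht|[b' [c' [Bb' hc' e]]]]].
      * have [[uU _] _] := pU0 ht; rewrite UsL //.
        by apply: filterS (TU t (conj Tt ht)) => n; left.
      (* Here the node of [T] is a branch [b'], and its successors come from the root of [S b']. *)
      * have c0 : c' = fset0 by apply: (glue_hat Bb'); rewrite -e; apply: TB.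
        have tb : t = b' by rewrite e c0 glue0.
        have Tb' : branches B0 T b' by rewrite -tb in Bb' *.
        rewrite e; apply: UT' => //; rewrite c0.
        by have [[_ _ ? _] _] := SP b' Tb'.
      * case: ht => /(glue_hat Tb.2) -> []; rewrite glue0; exact: Tb.2.
      * have [eb ec] := glue_uniq Tb.2 Bb' e.
        by apply: UT' => //; rewrite eb ec.
  move=> t [[Tt|[b' [c' [Tb' Sc' +]]]] [b [c [Bb Cc e]]]].
    case: (C_neq0 Bb Cc); apply: (glue_hat Bb); rewrite -e; exact: TB.
  rewrite e => /(glue_uniq Bb Tb'.2)[eb ec]; subst b' c'.
  by have [_ /(_ c (conj Sc' Cc))[]] := SP b Tb'.
Qed.
End FrontSum.

(** * Fubini iterations represented on fronts *)

(** Induction on the iteration: a p-point lives on the front of singletons, and a limit on the sum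
    in which the fronts of the factors are glued to the members of the front of [W]. *)
Lemma fubini_iteration_front W : fubini_iteration W ->
  exists (B : set {fset nat}) (Uc : {fset nat} -> set_system nat),
    [/\ flat_front B, nonprincipal_ppoints B Uc
      & isomorphic [set: nat] B W (generated B Uc)].
Proof.
elim=> {W} [W pW npW|W V U _ [B0 [U0 [fB0 pU0 [g0 g0bij g0P]]]] _ IHV [h hbij hP]].
- pose B := [set a : {fset nat} | #|` a| = 1].
  have B1 n : B [fset n]%fset by rewrite /B /mkset cardfs1.
  have B0 : ~ B fset0 by move=> /esym; rewrite cardfs0.
  have Bfront : front B.
    split=> [a b /eqP/cardfs1P[m ->] /eqP/cardfs1P[n ->] [[mn _] nmn]|X iX].
      by apply: nmn; have /fset1P-> := mn m (fset11 m).
    have [n [Xn nX]] : exists n, X n /\ forall m, X m -> n <= m.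
      have exX : exists n, `[< X n >].
        apply: contrapT => no; apply: iX; apply: (@bounded_finite _ 0) => x Xx.
        by case: no; exists x; apply/asboolP.
      case: (ex_minnP exX) => n /asboolP Xn nX.
      by exists n; split=> // m /asboolP/nX.
    exists [fset n]%fset => //; split; last first.
      by move=> e; apply: iX; rewrite -e.
    split=> [x /fset1P->//|x y Xx /fset1P-> xn]; apply/fset1P.
    by apply/eqP; rewrite eqn_leq xn nX.
  exists B, (fun _ => W); split=> //.
  + split=> // b n /fsetD1_fmax_card1-> _; rewrite fsetU0; exact: B1.
  + exists (fun n => [fset n]%fset).
      split=> [n _|m n _ _ /fset1_inj//|a /eqP/cardfs1P[n ->]]; [exact: B1|by exists n].
    move=> X XB; rewrite setTI; split=> [[_ [T [TB _ T0 TU] TX]]|WX].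
      have h0 : hatm B fset0 by split=> //; apply: hat0.
      have [uW _] := pW.
      apply: filterS (TU _ (conj T0 h0)) => n /=; rewrite fsetU0 => Tn.
      by apply: TX.
    split=> //; exists ([set fset0] `|` X).
      split.
      - by move=> t [->|/XB/hat_sub//]; apply: hat0.
      - move=> a b [->|Xb] ab; first by left; apply: init_seg_anti ab (init_seg0 _).
        have /eqP/cardfs1P[n] := XB b Xb; rewrite -[[fset n]%fset]fsetU0 => e.
        move: ab; rewrite e => /(init_seg_fset1U_inv _)[//|a0|->].
          by left; apply: init_seg_anti a0 (init_seg0 _).
        by right; rewrite -e.
      - by left.
      - move=> c [[->|/XB Bc] [_ //]] _.
        by have [uW _] := pW; apply: filterS WX => n Xn; right; rewrite fsetU0.
    by move=> t [[->//|//]].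
- have /choice[Cn /choice[Un CUP]] := IHV.
  have /choice[g gP] n : exists g : nat -> {fset nat},
      set_bij [set: nat] (Cn n) g /\ forall X, X `<=` Cn n ->
        generated (Cn n) (Un n) X <-> V n ([set: nat] `&` g @^-1` X).
    by have [_ _ [g gb gX]] := CUP n; exists g.
  (* [v] inverts [g0] on [B0], with default [0] elsewhere. It reindexes the factors, given for each
     number, by the members of [B0]. *)
  have /choice[v vP] b : exists n, B0 b -> g0 n = b.
    have [Bb|nB] := pselect (B0 b); last by exists 0.
    by case: g0bij => _ _ /(_ b Bb)[n _ <-]; exists n.
  have B0g n : B0 (g0 n) by case: g0bij => + _ _; apply.
  have g0inj : injective g0 by case: g0bij => _ + _ m n; apply; rewrite inE.
  have vg n : v (g0 n) = n by apply: g0inj; apply: vP.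
  have Cg n j : Cn n (g n j) by have [[+ _ _] _] := gP n; apply.
  have ginj n : injective (g n).
    by have [[_ + _] _] := gP n => + i j; apply; rewrite inE.
  have /choice[k kh] x : exists p, h p = x.
    by case: hbij => _ _ /(_ x I)[p _ <-]; exists p.
  have hk p : k (h p) = p.
    by case: hbij => _ + _; apply; rewrite ?inE.
  pose C b := Cn (v b); pose Ub b := Un (v b).
  have fC b : B0 b -> flat_front (C b) by have [] := CUP (v b).
  have pUb b : B0 b -> nonprincipal_ppoints (C b) (Ub b) by have [] := CUP (v b).
  exists (front_sum B0 C), (sum_ultrafilters B0 C U0 Ub); split.
  + exact: front_sum_flat.
  + exact: sum_ultrafilters_ppoints.
  (* The pair [p] stands for the member number [p.2] of the front of factor [p.1], glued to the
     member number [p.1] of [B0]. Composing with the inverse [k] of [h] gives the required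
     bijection. *)
  pose G p := glue (g0 p.1) (g p.1 p.2).
  have BG p : front_sum B0 C (G p).
    by exists (g0 p.1), (g p.1 p.2); rewrite /C vg.
  exists (fun x => G (k x)).
    split=> [x _|x y _ _ /(glue_uniq fB0 (B0g _) (B0g _))[/g0inj e1]|].
    * exact: BG.
    * rewrite e1 => /ginj e2; rewrite -(kh x) -(kh y).
      by rewrite [k x]surjective_pairing [k y]surjective_pairing e1 e2.
    * move=> _ [b [c [Bb Cc ->]]].
      have [[_ _ /(_ c Cc)[j _ <-]] _] := gP (v b).
      by exists (h (v b, j)) => //; rewrite hk /G /= vP.
  move=> X XB; rewrite generated_front_sum // g0P; last by move=> b [].
  have VG n : generated (C (g0 n)) (Ub (g0 n)) [set c | C (g0 n) c /\ X (glue (g0 n) c)]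
      <-> V n [set j | X (G (n, j))].
    rewrite /C /Ub vg (gP n).2; last by move=> c [].
    suff -> : [set: nat] `&` g n @^-1` [set c | Cn n c /\ X (glue (g0 n) c)] =
      [set j | X (G (n, j))] by [].
    by apply/seteqP; split=> j => [[_ []]|XG].
  rewrite hP // !setTI /fubini_lim /mkset.
  suff -> : g0 @^-1` [set b | B0 b /\
      generated (C b) (Ub b) [set c | C b c /\ X (glue b c)]] =
    [set n | V n [set j | X (G (k (h (n, j))))]] by [].
  have hkG n : [set j | X (G (k (h (n, j))))] = [set j | X (G (n, j))].
    by apply/seteqP; split=> j /=; rewrite hk.
  apply/seteqP; split=> n; rewrite /= hkG; first by move=> [_ /VG].
  by move=> /VG.
Qed.

Theorem theorem4p4 :
  (forall (B : set {fset nat}) (Uc : {fset nat} -> set_system nat),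
     flat_top_front B ->
     (forall c, hatm B c -> ppoint (Uc c) /\ nonprincipal (Uc c)) ->
     basic_Tukey_reductions B Uc) /\
  (forall W : set_system nat, fubini_iteration W ->
     exists (B : set {fset nat}) (Uc : {fset nat} -> set_system nat),
       [/\ flat_top_front B,
           (forall c, hatm B c -> ppoint (Uc c) /\ nonprincipal (Uc c)),
           isomorphic [set: nat] B W (generated B Uc)
         & basic_Tukey_reductions B Uc]).
Proof.
split=> [B Uc [fB _ _]|W /fubini_iteration_front[B [Uc [fB pU iso]]]].
  exact: front_basic_Tukey.
exists B, Uc; split=> //; first exact: flat_front_flat_top.
by apply: front_basic_Tukey => //; case: fB.
Qed.
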